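(* Let $n,m\ge 0$ be integers and $b_2\in\mathbb C$. As polynomials in $z,w$, $$U_{n,m}(0,b_2)=\begin{cases} b_{[n;m]_{\rm odd}}\; w^{\left(\frac n2\right)^2}\; U_{0,m+\frac n2}\!\left(\frac n2,b_2\right), & \text{if } n \text{ is even},\\[2mm] b_{[n;m]_{\rm odd}}\; w^{\left(\frac{n+2m+1}{2}\right)^2}\; U_{0,\frac{n-1}{2}}\!\left(m+\frac{n+1}{2},b_2\right), & \text{if } n \text{ is odd},\end{cases}$$ where $[n;m]_{\rm odd}=\{i\in[n;m]\mid i\text{ is odd}\}$ and $b_{[n;m]_{\rm odd}}$ is computed with $b=-4b_2^2$.
   Context: For nonnegative integers $n,m$ put $[n;m]=\{1,2,\ldots,n,n+2,n+4,\ldots,n+2m\}$. For a finite set $I$ of positive integers, $|I|$ denotes the SUM of its elements. For $I\subset[n;m]$ put $$\mathbf d_{n,m}(I)=\prod_{i\in I,\ j\in[n;m]\setminus I}\left|\frac{i+j}{i-j}\right|,\qquad \mathbf c(I)=\sum_{i\in I,\ i>n}\frac{i-n}{2}.$$ For parameters $a,b$ put $\bar a_k=a+(k-1)^2$, $\bar b_k=b+(k-1)^2$, and let the doubly-stepped products be denoted (with bold index to avoid confusion with the parameters $b_1,b_2$ of the claim) as follows: for a positive integer $i$, $a_i:=\prod_{1\le j\le i,\ j\equiv i\ (2)}\bar a_j$ and $b_i:=\prod_{1\le j\le i,\ j\equiv i\ (2)}\bar b_j$; for a set $I$, $a_I=\prod_{i\in I}a_i$, $b_I=\prod_{i\in I}b_i$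 (products of these numbers, where $b_i$ is NOT the parameter $b_1$ or $b_2$). Define $$U_{n,m}(z,w;a,b)=\sum_{I\subset[n;m]}\mathbf d_{n,m}(I)\,(-1)^{\mathbf c(I)}\,a_I\,b_{[n;m]\setminus I}\,z^{|I|}\,w^{|[n;m]\setminus I|}.$$ For complex parameters $\beta_1,\beta_2$ put $U_{n,m}(\beta_1,\beta_2):=U_{n,m}(z,w;-4\beta_1^2,-4\beta_2^2)$. (The polynomials $U_{0,m}$ are the Umemura polynomials.) *)

(* Defs.v *)
From HB Require Import structures.
From mathcomp Require Import all_boot all_order all_algebra.
From mathcomp Require Import finmap.
From mathcomp Require Import complex.
From mathcomp Require Import reals.
From mathcomp Require Import mpoly.

Set Implicit Arguments.
Unset Strict Implicit.
Unset Printing Implicit Defensive.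

Import Order.TTheory GRing.Theory Num.Theory.

Local Open Scope fset_scope.
Local Open Scope ring_scope.

Definition index_set (n m : nat) : {fset nat} :=
  [fset i in iota 1 n ++ [seq (n + 2 * k)%N | k <- iota 1 m]].

Definition setsum (I : {fset nat}) : nat := (\sum_(i <- I) i)%N.

Definition dcoef (K : numFieldType) (n m : nat) (I : {fset nat}) : K :=
  \prod_(i <- I) \prod_(j <- index_set n m `\` I)
    `|(i%:R + j%:R) / (i%:R - j%:R)|.

(* On subsets of [n;m] the difference [i - n] is even whenever [n < i], so
   the halving is exact. *)
Definition cexp (n : nat) (I : {fset nat}) : nat :=
  (\sum_(i <- I | (n < i)%N) (i - n)./2)%N.

Definition bar (K : numFieldType) (a : K) (k : nat) : K :=
  a + (k%:R - 1) ^+ 2.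

Definition stepprod (K : numFieldType) (a : K) (i : nat) : K :=
  \prod_(1 <= j < i.+1 | (j == i %[mod 2])%N) bar a j.

Definition stepprod_set (K : numFieldType) (a : K) (I : {fset nat}) : K :=
  \prod_(i <- I) stepprod a i.

Definition zvar (K : numFieldType) : {mpoly K[2]} := 'X_(@Ordinal 2 0 isT).
Definition wvar (K : numFieldType) : {mpoly K[2]} := 'X_(@Ordinal 2 1 isT).

Definition genU (K : numFieldType) (n m : nat) (a b : K) : {mpoly K[2]} :=
  \sum_(I <- fpowerset (index_set n m))
    (dcoef K n m I * (-1) ^+ cexp n I * stepprod_set a I
       * stepprod_set b (index_set n m `\` I))
    *: (zvar K ^+ setsum I * wvar K ^+ setsum (index_set n m `\` I)).

Definition U (K : numFieldType) (n m : nat) (beta1 beta2 : K) : {mpoly K[2]} :=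
  genU n m (- (4 * beta1 ^+ 2)) (- (4 * beta2 ^+ 2)).

Definition odd_part (n m : nat) : {fset nat} :=
  [fset i in index_set n m | odd i].

(* Main.v *)
Require Import Defs.
From HB Require Import structures.
From mathcomp Require Import all_boot all_order all_algebra.
From mathcomp Require Import finmap.
From mathcomp Require Import complex.
From mathcomp Require Import reals.
From mathcomp Require Import mpoly.
From mathcomp Require Import zify ring.

(** At [beta1 = 0] the first parameter is [a = 0], so [a_i] contains the factor
    [bar 0 1 = 0] for every odd [i]: only the sets [I] of even indices
    contribute to [U n m 0 b2] ([stepprod0_odd]).  The even elements of
    [n;m] are 2, 4, ..., 2N, which is [0;N], and the odd ones are
    1, 3, ..., 2q - 1, where [q = n/2], [N = m + n/2] for even [n], and
    [q = m + (n+1)/2], [N = (n-1)/2] for odd [n].  Hence the two sides are sums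
    over the same family of sets [I].  The odd indices always lie in the
    complement of [I]; they give the common factor [b_odd] and the power of [w]
    with exponent 1 + 3 + ... + (2q - 1) = q^2.

    What is left of [d_{n,m}(I)] after removing [d_{0,N}(I)] is, for each
    [i = 2k] in [I], the product over odd [j < 2q] of |(i + j) / (i - j)|.  Both
    parities reduce to the same identity for a single index ([coef_even]):
    this product, times the sign (-1)^max(k - q, 0) and times
    [a_2k] = ((2k-1)!!)^2, equals (-1)^k times the value of [a_2k] at the
    parameter -4 q^2.  It is proved by induction on [q], both sides being
    multiplied by (2q + 1 + 2k) / (2q + 1 - 2k) at each step: on the right
    because the product over [l < k] of
    (2l+1)^2 - 4 q^2 = (2l + 1 - 2q)(2l + 1 + 2q) telescopes ([prod_shift]), on
    the left because the truncated exponent k - q loses one exactly as long as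
    the new ratio is positive ([norm_ratio_sign]). *)

Set Implicit Arguments.
Unset Strict Implicit.
Unset Printing Implicit Defensive.

Import Order.TTheory GRing.Theory Num.Theory.

Local Open Scope fset_scope.
Local Open Scope ring_scope.

Section Coefficient.

Variable K : numFieldType.

Lemma stepprod_double (a : K) k :
  stepprod a k.*2 = \prod_(l < k) (a + (l.*2.+1)%:R ^+ 2).
Proof.
rewrite /stepprod; elim: k => [|k IHk]; first by rewrite big_geq ?big_ord0.
rewrite doubleS big_mkcond big_nat_recr //= big_nat_recr //= -big_mkcond /=.
have -> : (\prod_(1 <= j < k.*2.+1 | (j == k.*2.+2 %[mod 2])%N) bar a j) =
          \prod_(1 <= j < k.*2.+1 | (j == k.*2 %[mod 2])%N) bar a j.
  by apply: eq_bigl => j; lia.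
rewrite IHk big_ord_recr /= ifF ?mulr1; last by apply/negbTE; lia.
by rewrite ifT ?eqxx // /bar -[k.*2.+2]addn1 natrD addrK.
Qed.

(** The factor at [j = 1] is [bar 0 1 = 0]. *)
Lemma stepprod0_odd i : odd i -> stepprod (0 : K) i = 0.
Proof.
case: i => // i i_odd.
rewrite /stepprod big_mkcond big_nat_recl //= ifT; last by lia.
by rewrite /bar subrr expr0n addr0 mul0r.
Qed.

(** The factors are -(2x - (2l+1)) (2x + (2l+1)); replacing [x] by [x + 1] shifts
    both progressions by 2, so each half of the product only changes at its two
    ends.  Clearing denominators makes the identity polynomial in [x], valid
    also where a factor vanishes. *)
Lemma prod_shift (x : K) k :
  (2 * x + 1 - 2 * k%:R) * \prod_(l < k) (- (4 * (x + 1) ^+ 2) + (l.*2.+1)%:R ^+ 2)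
  = (2 * x + 1 + 2 * k%:R) * \prod_(l < k) (- (4 * x ^+ 2) + (l.*2.+1)%:R ^+ 2).
Proof.
elim: k => [|k IHk]; first by rewrite !big_ord0; ring.
rewrite !big_ord_recr /=.
set P := \prod_(l < k) _ in IHk *; set Q := \prod_(l < k) _ in IHk *.
rewrite -[k.*2.+1]addn1 -mul2n natrD natrM -[k.+1]addn1 natrD.
(* The last factor of the shifted product is -(2x + 1 - 2k) (2x + 3 + 2k): its
   first half is the multiplier that the induction hypothesis needs. *)
transitivity (- (2 * x - 1 - 2 * k%:R) * (2 * x + 3 + 2 * k%:R)
              * ((2 * x + 1 - 2 * k%:R) * P)); first by ring.
by rewrite IHk; ring.
Qed.

(** The ratio of odd index [2p + 1] is positive exactly when [p < k], which is
    also when the truncated exponents [k - p.+1] and [k - p] differ by one.  So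
    the sign created by the absolute value is cancelled in both cases. *)
Lemma norm_ratio_sign p k :
  `|((k.*2)%:R + (p.*2.+1)%:R) / ((k.*2)%:R - (p.*2.+1)%:R)| * (-1) ^+ (k - p.+1)
  = (-1) ^+ (k - p) * ((2 * p%:R + 1 + 2 * k%:R) / (2 * p%:R + 1 - 2 * k%:R)) :> K.
Proof.
have -> : 2 * p%:R + 1 + 2 * k%:R = (k.*2)%:R + (p.*2.+1)%:R :> K.
  by rewrite -!muln2 -addn1 !natrD !natrM; ring.
have -> : 2 * p%:R + 1 - 2 * k%:R = - ((k.*2)%:R - (p.*2.+1)%:R) :> K.
  by rewrite -!muln2 -addn1 !natrD !natrM; ring.
rewrite normrM normfV -natrD normr_nat invrN.
case: (ltnP p k) => pk.
  rewrite -natrB; last by lia.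
  have -> : (k - p = (k - p.+1).+1)%N by lia.
  by rewrite normr_nat exprS; ring.
rewrite distrC ger0_norm; last by rewrite subr_ge0 ler_nat; lia.
have [-> ->] : (k - p = 0)%N /\ (k - p.+1 = 0)%N by lia.
by rewrite -[in LHS]opprB invrN !expr0 mulr1 mul1r.
Qed.

(** The identity for one index [2k]: absorbing the ratios with the odd numbers
    below [2p] turns the parameter 0 into -4 p^2. *)
Lemma coef_even p k :
  (\prod_(j < p) `|((k.*2)%:R + (j.*2.+1)%:R) / ((k.*2)%:R - (j.*2.+1)%:R)|)
    * (-1) ^+ (k - p) * stepprod 0 k.*2
  = (-1) ^+ k * stepprod (- (4 * p%:R ^+ 2)) k.*2 :> K.
Proof.
elim: p => [|p IHp].
  by rewrite big_ord0 subn0 mul1r expr0n mulr0 oppr0.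
rewrite big_ord_recr /= -[X in X * _]mulrA norm_ratio_sign.
rewrite [X in X * _]mulrA [LHS]mulrAC IHp !stepprod_double -mulrA.
congr (_ * _).
(* The denominator is an odd integer minus an even one. *)
have nz : 2 * p%:R + 1 - 2 * k%:R != 0 :> K.
  by rewrite subr_eq0 -!natrM natr1 eqr_nat; lia.
apply: (mulfI nz); rewrite -[p.+1]addn1 natrD prod_shift.
by field.
Qed.

End Coefficient.

Lemma mem_index_set n m i :
  (i \in index_set n m) =
  (0 < i <= n)%N || [&& n < i, i <= n + 2 * m & odd i == odd n]%N.
Proof.
rewrite /index_set !inE mem_iota.
have -> : (i \in [seq (n + 2 * k)%N | k <- iota 1 m]) =
          [&& n < i, i <= n + 2 * m & odd i == odd n]%N.
  apply/mapP/idP => [[k]|H]; first by rewrite mem_iota => *; lia.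
  by exists ((i - n)./2); rewrite ?mem_iota; lia.
by congr (_ || _); lia.
Qed.

(** Both parities of [n] are treated at once: the odd elements of [n;m] are
    those below [2q], the even ones those up to [2N], and the exponent that an
    even [i] contributes to [cexp n] is the truncated difference [i/2 - q].  For
    odd [n] this last exponent is 0 on both sides, as [i < n < 2q]. *)
Section Reduction.

Variables (K : numFieldType) (n m q N : nat).
Hypothesis mem_S : forall i,
  (i \in index_set n m) = if odd i then (i < q.*2)%N else (0 < i <= N.*2)%N.
Hypothesis half_shift : forall i, i \in index_set n m -> ~~ odd i ->
  (if n < i then (i - n)./2 else 0)%N = (i./2 - q)%N.

Let S := index_set n m.
Let E := index_set 0 N.
Let odds := [seq j.*2.+1 | j <- iota 0 q].

Lemma mem_E i : (i \in E) = (i \in S) && ~~ odd i.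
Proof. by rewrite mem_S mem_index_set; case: ifP; lia. Qed.

Lemma mem_odds i : (i \in odds) = (i \in S) && odd i.
Proof.
rewrite mem_S; apply/mapP/idP => [[k]|].
  by rewrite mem_iota => ? ->; case: ifP; lia.
by case: ifP => // ? /andP[]; exists i./2; rewrite ?mem_iota; lia.
Qed.

Lemma odds_uniq : uniq odds.
Proof. by rewrite map_inj_uniq ?iota_uniq // => i j; lia. Qed.

Lemma perm_odd_part : perm_eq (odd_part n m) odds.
Proof.
apply: uniq_perm; rewrite ?fset_uniq ?odds_uniq // => i.
by rewrite mem_odds /odd_part !inE.
Qed.

Lemma perm_compl (I : {fset nat}) : I `<=` E ->
  perm_eq (S `\` I) (odds ++ (E `\` I)).
Proof.
move=> /fsubsetP IE; apply: uniq_perm => [||i]; first exact: fset_uniq.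
  rewrite cat_uniq odds_uniq fset_uniq andbT /=; apply/hasPn => i.
  by rewrite in_fsetD mem_E mem_odds => /and3P[_ ->].
have := IE i; rewrite mem_cat !in_fsetD mem_odds mem_E.
by case: (i \in I) => /= [/(_ isT)|_]; case: (i \in S); case: (odd i).
Qed.

Lemma sum_odds : (\sum_(i <- odds) i = q ^ 2)%N.
Proof.
rewrite big_map; elim: q => [|r IHr]; first by rewrite big_nil.
by rewrite -[r.+1]addn1 iotaD big_cat /= big_seq1 IHr; lia.
Qed.

(** All three factors of the coefficient are products over [i] in [I]; factor by
    factor, the two sides differ by the ratios with odd [j], which
    [coef_even] evaluates. *)
Lemma term_even (b : K) (I : {fset nat}) : I `<=` E ->
  dcoef K n m I * (-1) ^+ cexp n I * stepprod_set 0 I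
  = dcoef K 0 N I * (-1) ^+ cexp 0 I * stepprod_set (- (4 * q%:R ^+ 2)) I.
Proof.
move=> IE; have memI i : i \in I -> (i \in S) && ~~ odd i.
  by rewrite -mem_E; apply: (fsubsetP IE).
rewrite /dcoef /cexp /stepprod_set.
have -> : (\sum_(i <- I | n < i) (i - n)./2 = \sum_(i <- I) (i./2 - q))%N.
  rewrite big_mkcond big_seq [RHS]big_seq; apply: eq_bigr => i /memI/andP[iS iE].
  exact: half_shift.
have -> : (\sum_(i <- I | 0 < i) (i - 0)./2 = \sum_(i <- I) i./2)%N.
  by rewrite big_mkcond; apply: eq_bigr => -[|i] _; rewrite ?subn0.
rewrite !expr_sum -!big_split /= big_seq [RHS]big_seq.
apply: eq_bigr => i /memI/andP[_ /even_halfK i2].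
rewrite (perm_big _ (perm_compl IE)) big_cat /= big_map.
rewrite [X in X * _ * _]mulrC -!mulrA; congr (_ * _).
have := coef_even K q i./2; rewrite i2 => <-.
by rewrite -mulrA -(big_mkord xpredT (fun j =>
  `|(i%:R + (j.*2.+1)%:R) / (i%:R - (j.*2.+1)%:R)|)) /index_iota subn0.
Qed.

Lemma U_zero (b2 : K) :
  U n m 0 b2 =
  stepprod_set (- (4 * b2 ^+ 2)) (odd_part n m)
    *: (wvar K ^+ (q ^ 2) * U 0 N q%:R b2).
Proof.
rewrite /U /genU expr0n mulr0 oppr0 -/S -/E.
have ES : fpowerset E `<=` fpowerset S.
  apply/fsubsetP => I; rewrite !fpowersetE => /fsubsetP IE.
  by apply/fsubsetP => i /IE; rewrite mem_E => /andP[].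
(* A set that is not contained in [E] has an odd element, which kills its
   term. *)
rewrite -(big_fset_incl _ ES) => [|I]; last first.
  rewrite !fpowersetE => /fsubsetP IS /fsubsetPn[i iI].
  rewrite mem_E IS //= negbK => i_odd.
  rewrite /stepprod_set (big_rem i iI) /= stepprod0_odd //.
  by rewrite mul0r mulr0 mul0r scale0r.
rewrite mulr_sumr scaler_sumr big_seq [RHS]big_seq.
apply: eq_bigr => I; rewrite fpowersetE => IE.
rewrite term_even //.
have -> : setsum (S `\` I) = (q ^ 2 + setsum (E `\` I))%N.
  by rewrite /setsum (perm_big _ (perm_compl IE)) big_cat /= sum_odds.
have -> : stepprod_set (- (4 * b2 ^+ 2)) (S `\` I)
  = stepprod_set (- (4 * b2 ^+ 2)) (odd_part n m)
    * stepprod_set (- (4 * b2 ^+ 2)) (E `\` I).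
  rewrite /stepprod_set (perm_big _ (perm_compl IE)) big_cat /=.
  by rewrite (perm_big _ perm_odd_part).
rewrite -scalerAr scalerA exprD; by congr (_ *: _); rewrite mulrCA.
Qed.

End Reduction.

Theorem lemma7 (R : realType) (n m : nat) (b2 : R[i]) :
  U n m 0 b2 =
  if ~~ odd n then
    stepprod_set (- (4 * b2 ^+ 2)) (odd_part n m)
      *: (wvar R[i] ^+ ((n./2) ^ 2)
          * U 0 (m + n./2) (n%:R / 2) b2)
  else
    stepprod_set (- (4 * b2 ^+ 2)) (odd_part n m)
      *: (wvar R[i] ^+ (((n + 2 * m + 1)./2) ^ 2)
          * U 0 ((n - 1)./2) (m%:R + (n%:R + 1) / 2) b2).
Proof.
case: ifP => [n_even|/negbFE n_odd].
  have -> : n%:R / 2 = (n./2)%:R :> R[i].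
    by rewrite -[in LHS](even_halfK n_even) -muln2 natrM mulfK // pnatr_eq0.
  apply: U_zero => i; last first.
    by move=> iS; case: ltnP; lia.
  by rewrite mem_index_set; case: ifP; lia.
have -> : m%:R + (n%:R + 1) / 2 = ((n + 2 * m + 1)./2)%:R :> R[i].
  have -> : ((n + 2 * m + 1)./2 = m + (n.+1)./2)%N by lia.
  rewrite natrD; congr (_ + _); rewrite natr1.
  have {1}-> : (n.+1 = (n.+1)./2 * 2)%N by lia.
  by rewrite natrM mulfK // pnatr_eq0.
apply: U_zero => i; last first.
  by rewrite mem_index_set => /orP iS; case: ltnP; lia.
by rewrite mem_index_set; case: ifP; lia.
Qed.
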